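(* Let $T\in\mathbb{R}^{n\times n}$ be a nonsingular totally nonnegative banded matrix with $p$ subdiagonals and $q$ superdiagonals ($0\le p,q\le n$). Then $T$ is banded totally positive, i.e. all its nontrivial minors are positive, if and only if all the nontrivial minors among $\Delta^i(T)$ and $\Delta_i(T)$, $i\in\{1,\dots,n\}$, are nonzero.
   Context: Rows and columns are labelled $1,\dots,n$. A matrix $T\in\mathbb{R}^{n\times n}$ belongs to $B_{p,q}$ (banded with $p$ subdiagonals and $q$ superdiagonals) if $T_{i,j}=0$ whenever $j>i+q$ or $i>j+p$. For increasing sequences $i_1<\dots<i_r$ and $j_1<\dots<j_r$ in $\{1,\dots,n\}$, the associated submatrix has entries $(T_{i_k,j_l})_{k,l=1}^r$ and the associated minor is its determinant. For $T\in B_{p,q}$ the submatrix (and its minor) is called trivial (with respect to $(p,q)$) if there is $k\in\{1,\dots,r\}$ such that $j_k>i_k+q$ or $i_k>j_k+p$; otherwise it is nontrivial. A matrix is totally nonnegative if all its minors are $\ge 0$. $\Delta^i(T)$ is the minor of $T$ with rows $1,\dots,i$ and columns $n-i+1,\dots,n$; $\Delta_i(T)$ is the minor with rows $n-i+1,\dots,n$ and columns $1,\dots,i$. *)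

(* Defs.v *)
From mathcomp Require Import all_boot all_order all_algebra.
From mathcomp Require Import reals.

Set Implicit Arguments.
Unset Strict Implicit.
Unset Printing Implicit Defensive.

Import Order.TTheory GRing.Theory Num.Theory.
Local Open Scope ring_scope.

(* Rows and columns are indexed from 0 by 'I_n; every condition below only
   compares row indices with column indices, so the shift is immaterial. *)

Definition banded (R : realType) (n p q : nat) (T : 'M[R]_n) : Prop :=
  forall i j : 'I_n, (i + q < j)%N || (j + p < i)%N -> T i j = 0.

Definition increasing (r n : nat) (f : 'I_r -> 'I_n) : Prop :=
  forall k l : 'I_r, (k < l)%N -> (f k < f l)%N.

Definition minor (R : realType) (n r : nat) (f g : 'I_r -> 'I_n)
  (T : 'M[R]_n) : R := \det (mxsub f g T).

Definition trivial_sub (n r p q : nat) (f g : 'I_r -> 'I_n) : bool :=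
  [exists k : 'I_r, (f k + q < g k)%N || (g k + p < f k)%N].

Definition nontrivial_sub (n r p q : nat) (f g : 'I_r -> 'I_n) : bool :=
  ~~ trivial_sub p q f g.

(* The size r = 0 is allowed in the next two definitions, harmlessly: the empty
   minor is 1. *)
Definition totally_nonnegative (R : realType) (n : nat) (T : 'M[R]_n) : Prop :=
  forall (r : nat) (f g : 'I_r -> 'I_n),
    increasing f -> increasing g -> 0 <= minor f g T.

Definition banded_totally_positive (R : realType) (n p q : nat)
  (T : 'M[R]_n) : Prop :=
  forall (r : nat) (f g : 'I_r -> 'I_n),
    increasing f -> increasing g -> nontrivial_sub p q f g ->
    0 < minor f g T.

Definition first_idx (n i : nat) (hi : (i <= n)%N) : 'I_i -> 'I_n :=
  widen_ord hi.

(* k |-> n - i + k *)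
Definition last_idx (n i : nat) (hi : (i <= n)%N) (k : 'I_i) : 'I_n :=
  cast_ord (subnK hi) (rshift (n - i) k).

(* Delta^i(T) *)
Definition upper_corner_minor (R : realType) (n i : nat) (hi : (i <= n)%N)
  (T : 'M[R]_n) : R := minor (first_idx hi) (last_idx hi) T.

(* Delta_i(T) *)
Definition lower_corner_minor (R : realType) (n i : nat) (hi : (i <= n)%N)
  (T : 'M[R]_n) : R := minor (last_idx hi) (first_idx hi) T.

(* Main.v *)
(* The corner submatrices whose minors are assumed nonzero are nonsingular and
   totally nonnegative, so their principal minors are positive; every
   nontrivial minor with consecutive rows and consecutive columns is one of
   these.  A general nontrivial minor on rows f and columns g is treated by
   induction on its order and then on its span
   (f_max - f_0) + (g_max - g_0).  If f_{k+1} > g_k + p or g_{k+1} > f_k + q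
   for some k, the submatrix is block triangular and its minor is a product of
   smaller nontrivial minors.  Otherwise, if f skips a row h, exchanging f_0 for
   h gives a nontrivial minor of smaller span, and a three-term determinantal
   relation transfers its positivity back to f; gaps in g are handled by
   transposition. *)

Require Import Defs.
From mathcomp Require Import all_boot all_order all_algebra.
From mathcomp Require Import perm reals zify.

Set Implicit Arguments.
Unset Strict Implicit.
Unset Printing Implicit Defensive.

Import Order.TTheory GRing.Theory Num.Theory.
Local Open Scope ring_scope.

(** * Increasing index maps *)

Lemma increasing_comp (r m n : nat) (f : 'I_r -> 'I_m) (h : 'I_m -> 'I_n) :
  increasing f -> increasing h -> increasing (h \o f).
Proof. by move=> incf inch k l lt_kl; apply/inch/incf. Qed.

Lemma increasing_leq (r n : nat) (f : 'I_r -> 'I_n) (k l : 'I_r) :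
  increasing f -> (k <= l)%N -> (f k <= f l)%N.
Proof.
move=> incf; rewrite leq_eqVlt => /orP[/eqP/val_inj->//|lt_kl].
exact/ltnW/incf.
Qed.

Lemma increasing_lift (n : nat) (i : 'I_n.+1) : increasing (lift i).
Proof. by move=> k l; rewrite /= !ltnNge leq_bump2. Qed.

Lemma increasing_first_idx (n i : nat) (hi : (i <= n)%N) :
  increasing (first_idx hi).
Proof. by []. Qed.

Lemma increasing_last_idx (n i : nat) (hi : (i <= n)%N) :
  increasing (last_idx hi).
Proof. by move=> k l; rewrite /= ltn_add2l. Qed.

(** * Minors under submatrices and transposition, and the row insertion step *)

Section Minors.

Variable R : realType.

Lemma eq_minor (n r : nat) (f f' g g' : 'I_r -> 'I_n) (T : 'M[R]_n) :
  f =1 f' -> g =1 g' -> minor f g T = minor f' g' T.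
Proof.
by move=> eqf eqg; congr (\det _); apply/matrixP => i j; rewrite !mxE eqf eqg.
Qed.

Lemma minor0 (n : nat) (f g : 'I_0 -> 'I_n) (T : 'M[R]_n) : minor f g T = 1.
Proof. exact: det_mx00. Qed.

Lemma minor_tr (n r : nat) (f g : 'I_r -> 'I_n) (T : 'M[R]_n) :
  minor f g T^T = minor g f T.
Proof. by rewrite /minor -trmx_mxsub det_tr. Qed.

Lemma minor_mxsub (n m r : nat) (f g : 'I_r -> 'I_m) (a b : 'I_m -> 'I_n)
    (T : 'M[R]_n) :
  minor f g (mxsub a b T) = minor (a \o f) (b \o g) T.
Proof. by rewrite /minor -mxsub_comp. Qed.

Lemma tr_tnn (n : nat) (T : 'M[R]_n) :
  totally_nonnegative T -> totally_nonnegative T^T.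
Proof. by move=> tnT r f g incf incg; rewrite minor_tr; apply: tnT. Qed.

Lemma mxsub_tnn (n m : nat) (a b : 'I_m -> 'I_n) (T : 'M[R]_n) :
  increasing a -> increasing b ->
  totally_nonnegative T -> totally_nonnegative (mxsub a b T).
Proof.
move=> inca incb tnT r f g incf incg; rewrite minor_mxsub.
by apply: tnT; apply: increasing_comp.
Qed.

Lemma minor_block0 (n a b : nat) (f g : 'I_(a + b) -> 'I_n) (T : 'M[R]_n) :
  (forall i j, T (f (rshift a i)) (g (lshift b j)) = 0) ->
  minor f g T =
    minor (f \o lshift b) (g \o lshift b) T *
    minor (f \o @rshift a b) (g \o @rshift a b) T.
Proof.
move=> T0; rewrite /minor -[mxsub f g T]submxK.
have -> : dlsubmx (mxsub f g T) = 0 by apply/matrixP => i j; rewrite !mxE.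
rewrite det_ublock; congr (_ * _); congr (\det _);
  by apply/matrixP => i j; rewrite !mxE.
Qed.

(** The generalized cross product of the columns of [A]: a row vector orthogonal to each of them. *)
Definition alternating_minors (r : nat) (A : 'M[R]_(r.+1, r)) : 'rV[R]_r.+1 :=
  \row_i ((-1) ^+ i * \det (row' i A)).

Lemma alternating_minorsM (r : nat) (A : 'M[R]_(r.+1, r)) :
  alternating_minors A *m A = 0.
Proof.
apply/rowP => j; rewrite !mxE.
(* [M] is [A] with a copy of its column [j] put in front; expanding its zero determinant along that
   copy gives the claim. *)
pose M := \matrix_(i, k) A i (odflt j (unlift ord0 k)).
have detM : \det M = 0.
  rewrite -det_tr; apply: (@determinant_alternate _ _ _ ord0 (lift ord0 j)).
    by rewrite neq_lift.
  by move=> i; rewrite !mxE unlift_none liftK.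
rewrite -[RHS]detM (expand_det_col M ord0); apply: eq_bigr => i _.
rewrite !mxE unlift_none /= mulrC /cofactor addn0; congr (_ * (_ * \det _)).
by apply/matrixP => k l; rewrite !mxE liftK.
Qed.

(* If the minor vanished, the (r+1) x (r+1) submatrix B on rows F \o lift s
   would have corank one; its left kernel would then contain two proportional
   vectors x (alternating minors of the r+2 rows F) and w (last row of \adj B).
   Total nonnegativity fixes the signs of their end entries, and these are
   incompatible with proportionality. *)
Lemma minor_insert_gt0 (n r : nat) (T : 'M[R]_n)
    (F : 'I_r.+2 -> 'I_n) (g : 'I_r.+1 -> 'I_n) (s : 'I_r.+2) :
  totally_nonnegative T -> increasing F -> increasing g -> (0 < s < r.+1)%N ->
  0 < minor (F \o lift ord0) g T ->
  0 < minor (F \o lift s \o lift ord_max) (g \o lift ord_max) T ->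
  0 < @minor R n r.+1 (F \o lift s) g T.
Proof.
move=> tnT incF incg /andP[s_gt0 s_ltr] gt0_first gt0_corner.
have incFl i : increasing (F \o lift i).
  exact: increasing_comp (@increasing_lift _ i) incF.
rewrite lt0r [X in _ && X](tnT _ _ _ (incFl s) incg) andbT.
apply/eqP => det0.
pose A := mxsub F g T; pose B := mxsub (F \o lift s) g T.
pose v := alternating_minors A.
pose x : 'rV_r.+1 := col' s v.
have v0 i : v 0 i = (-1) ^+ i * @minor R n r.+1 (F \o lift i) g T.
  by rewrite mxE; congr (_ * \det _); apply/matrixP => k l; rewrite !mxE.
(* Up to sign, entry [s] of [v] is the minor assumed to vanish, so row [s] of [A] drops out of the
   relation. *)
have xB : x *m B = 0.
  apply/rowP => j; rewrite -(alternating_minorsM A) mxE [RHS]mxE.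
  rewrite [RHS](bigD1_ord s) //= -/v v0 det0 mulr0 mul0r add0r.
  by apply: eq_bigr => i _; rewrite [x _ _]mxE !(mxE _ _ _ j).
pose w := row ord_max (\adj B).
have wB : w *m B = 0 by rewrite -row_mul mul_adj_mx [\det B]det0 raddf0 row0.
have w0 i : w 0 i =
    (-1) ^+ (i + r) * minor (F \o lift s \o lift i) (g \o lift ord_max) T.
  rewrite !mxE /cofactor; congr (_ * \det _).
  by apply/matrixP => k l; rewrite !mxE.
(* This combination of kernel vectors has last entry 0, so its other entries form a kernel vector of
   [B] without its last row and column. That block is invertible, hence [z] vanishes. *)
pose z := w 0 ord_max *: x - x 0 ord_max *: w.
have zE i : z 0 i = w 0 ord_max * x 0 i - x 0 ord_max * w 0 i.
  by rewrite mxE [X in X + _]mxE [X in _ + X]mxE [X in - X]mxE.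
have xE i : x 0 i = v 0 (lift s i) by rewrite mxE.
have zB : z *m B = 0 by rewrite mulmxBl -!scalemxAl xB wB !scaler0 subr0.
have z_max : z 0 ord_max = 0 by rewrite zE mulrC subrr.
have zC : col' ord_max z *m mxsub (lift ord_max) (lift ord_max) B = 0.
  apply/rowP => j; transitivity ((z *m B) 0 (lift ord_max j)); last first.
    by rewrite zB !mxE.
  rewrite mxE [RHS]mxE [RHS](bigD1_ord ord_max) //= z_max mul0r add0r.
  by apply: eq_bigr => i _; congr (_ * _); rewrite [LHS]mxE.
have Cunit : mxsub (lift ord_max) (lift ord_max) B \in unitmx.
  by rewrite unitmxE unitfE -mxsub_comp gt_eqF.
have z'0 : col' ord_max z = 0 by rewrite -[LHS](mulmxK Cunit) zC mul0mx.
have z0 : z 0 ord0 = 0.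
  have r_gt0 : (0 < r)%N by lia.
  have /rowP/(_ (Ordinal r_gt0)) := z'0.
  rewrite [X in X = _ -> _]mxE [X in _ = X -> _]mxE => <-.
  by congr (z _ _); apply: val_inj => /=; rewrite /bump; lia.
have lift0E : lift s ord0 = ord0.
  by apply: val_inj; rewrite /= /bump; lia.
have liftmE : lift s ord_max = ord_max.
  by apply: val_inj; rewrite /= /bump; lia.
(* The first term of [z 0 ord0] is the product of the two minors assumed positive. In the second,
   the signs of [x] at the end and of [w] at the start multiply to -1, so subtracting it adds a
   nonnegative number. *)
have : 0 < z 0 ord0; last by rewrite z0 ltxx.
rewrite zE !xE lift0E liftmE !w0 !v0 /= add0n addnn -mul2n exprM sqrrN.
rewrite !expr1n mul1r expr0 mul1r.
rewrite ltr_wpDr ?mulr_gt0 // exprS mulN1r !mulNr opprK mulrACA -exprD addnn.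
rewrite -mul2n exprM sqrrN !expr1n mul1r.
apply: mulr_ge0; apply: tnT => //.
  exact: increasing_comp (@increasing_lift _ _) (incFl _).
exact: increasing_comp (@increasing_lift _ _) incg.
Qed.

End Minors.

(** * Positivity of contiguous principal minors of nonsingular totally nonnegative matrices *)

Section PrincipalMinors.

Variable R : realType.

Definition schur (m : nat) (A : 'M[R]_m.+1) : 'M[R]_m :=
  \matrix_(i, j) (A (lift ord0 i) (lift ord0 j)
                  - A (lift ord0 i) ord0 / A ord0 ord0 * A ord0 (lift ord0 j)).

Lemma det_schur (m : nat) (A : 'M[R]_m.+1) :
  A ord0 ord0 != 0 -> \det A = A ord0 ord0 * \det (schur A).
Proof.
move=> a_neq0; pose C : 'M[R]_(1 + m) := A.
pose L : 'M[R]_(1 + m) :=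
  block_mx 1%:M 0 ((A ord0 ord0)^-1 *: dlsubmx C) 1%:M.
pose U : 'M[R]_(1 + m) := block_mx (ulsubmx C) (ursubmx C) 0 (schur A).
have ulC : ulsubmx C = (A ord0 ord0)%:M.
  by rewrite [LHS]mx11_scalar !mxE; congr (A _ _)%:M; apply: val_inj.
have drC : drsubmx C = (A ord0 ord0)^-1 *: dlsubmx C *m ursubmx C + schur A.
  apply/matrixP => i j; rewrite !mxE big_ord1 !mxE !rshift1.
  by rewrite !ord1 !lshift0 mulrAC [_ / _]mulrC mulrAC addrC subrK.
have CE : C = L *m U.
  rewrite mulmx_block !mul1mx !mul0mx !addr0 ulC mul_mx_scalar.
  by rewrite scalerA divff // scale1r -drC -ulC submxK.
rewrite -[LHS]/(\det C) CE det_mulmx det_lblock !det1 !mul1r det_ublock ulC.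
by rewrite det_scalar1.
Qed.

Definition ord_cons (r m : nat) (f : 'I_r -> 'I_m) (k : 'I_r.+1) : 'I_m.+1 :=
  oapp (lift ord0 \o f) ord0 (unlift ord0 k).

Lemma increasing_ord_cons (r m : nat) (f : 'I_r -> 'I_m) :
  increasing f -> increasing (ord_cons f).
Proof.
move=> incf k l; rewrite /ord_cons.
case: (unliftP ord0 k) => [k'|] ->; case: (unliftP ord0 l) => [l'|] -> //=.
by rewrite !ltnS => /incf.
Qed.

(** Eliminating the pivot commutes with passing to submatrices that keep the pivot row and column.
    This carries total nonnegativity over to [schur A] when the pivot is positive. *)
Lemma minor_schur (m r : nat) (f g : 'I_r -> 'I_m) (A : 'M[R]_m.+1) :
  A ord0 ord0 != 0 ->
  minor (ord_cons f) (ord_cons g) A = A ord0 ord0 * minor f g (schur A).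
Proof.
move=> a_neq0; rewrite /minor det_schur /ord_cons !mxE unlift_none //=.
congr (_ * \det _); apply/matrixP => i j.
by rewrite !mxE !liftK unlift_none.
Qed.

(** If the corner were 0, nonsingularity would give nonzero, hence positive, entries [A i ord0] and
    [A ord0 j], and the minor on rows 0, i and columns 0, j would be minus their product. *)
Lemma tnn_corner_gt0 (m : nat) (A : 'M[R]_m.+1) :
  totally_nonnegative A -> \det A != 0 -> 0 < A ord0 ord0.
Proof.
move=> tnA detA.
have A_ge0 i j : 0 <= A i j.
  have := tnA 1 (fun=> i) (fun=> j); rewrite /minor det_mx11 mxE.
  by apply=> k l; rewrite !ord1.
rewrite lt0r A_ge0 andbT; apply/negP => /eqP a0.
have [i Ai0] : exists i, A i ord0 != 0.
  apply/existsP; apply: contraNT detA; rewrite negb_exists => /forallP A0.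
  rewrite (expand_det_col A ord0) big1 // => i _.
  by move: (A0 i); rewrite negbK => /eqP ->; rewrite mul0r.
have [j A0j] : exists j, A ord0 j != 0.
  apply/existsP; apply: contraNT detA; rewrite negb_exists => /forallP A0.
  rewrite (expand_det_row A ord0) big1 // => j _.
  by move: (A0 j); rewrite negbK => /eqP ->; rewrite mul0r.
pose pair (k : 'I_m.+1) (l : 'I_2) := if l == ord0 then ord0 else k.
have inc_pair k : k != ord0 -> increasing (pair k).
  move=> k_neq0 [[|[|//]] ?] [[|[|//]] ?] //= _.
  by rewrite /pair /= lt0n; apply: contraNneq k_neq0 => k0; apply/eqP/val_inj.
have i_neq0 : i != ord0 by apply: contraNneq Ai0 => ->; rewrite a0.
have j_neq0 : j != ord0 by apply: contraNneq A0j => ->; rewrite a0.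
have := tnA _ _ _ (inc_pair _ i_neq0) (inc_pair _ j_neq0).
rewrite /minor (expand_det_row _ ord0) !big_ord_recl big_ord0 /cofactor.
rewrite !det_mx11 !mxE /pair /= a0 mul0r add0r addr0 expr1 mulN1r mulrN.
rewrite oppr_ge0.
by rewrite leNgt mulr_gt0 // lt0r ?Ai0 ?A0j A_ge0.
Qed.

(** Induction on the order through the Schur complement of the corner entry, which is again
    nonsingular and totally nonnegative. *)
Lemma leading_minor_gt0 (m : nat) (A : 'M[R]_m) (k : nat) (hk : (k <= m)%N) :
  totally_nonnegative A -> \det A != 0 ->
  0 < minor (first_idx hk) (first_idx hk) A.
Proof.
elim: m A k hk => [|m IH] A [|k] hk tnA detA; rewrite ?minor0 ?ltr01 //.
have a_gt0 := tnn_corner_gt0 tnA detA.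
have a_neq0 : A ord0 ord0 != 0 by rewrite gt_eqF.
have hk' : (k <= m)%N by [].
have consE : first_idx hk =1 ord_cons (first_idx hk').
  move=> i; apply: val_inj; rewrite /= /ord_cons.
  by case: unliftP => [j|] ->.
rewrite (eq_minor _ consE consE) minor_schur // mulr_gt0 //.
apply: IH => [r f g incf incg|].
  rewrite -(pmulr_rge0 _ a_gt0) -minor_schur //.
  by apply: tnA; apply: increasing_ord_cons.
by apply: contraNneq detA => det0; rewrite det_schur // det0 mulr0.
Qed.

Lemma det_rev (r : nat) (A : 'M[R]_r) :
  \det (mxsub (@rev_ord r) (@rev_ord r) A) = \det A.
Proof.
pose s := perm (@rev_ord_inj r).
have -> : mxsub (@rev_ord r) (@rev_ord r) A = row_perm s (col_perm s A).
  by apply/matrixP => i j; rewrite !mxE !permE.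
rewrite row_permE col_permE !det_mulmx !det_perm odd_permV mulrCA -expr2.
by rewrite sqrr_sign mulr1.
Qed.

(** Reversing both index orders leaves determinants unchanged; it serves to turn trailing principal
    minors into leading ones. *)
Lemma rev_tnn (m : nat) (A : 'M[R]_m) :
  totally_nonnegative A ->
  totally_nonnegative (mxsub (@rev_ord m) (@rev_ord m) A).
Proof.
move=> tnA r f g incf incg; rewrite minor_mxsub /minor -det_rev -mxsub_comp.
have inc_rev h : increasing h ->
    increasing ((@rev_ord m \o h) \o @rev_ord r : 'I_r -> 'I_m).
  move=> inch k l lt_kl /=; have lt_rev : (rev_ord l < rev_ord k)%N.
    by rewrite /=; have := ltn_ord l; lia.
  by have := inch _ _ lt_rev; have := ltn_ord (h (rev_ord k)); lia.
by apply: tnA; apply: inc_rev.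
Qed.

(** The minor is a trailing one of the leading block of order a + r. That block is nonsingular by
    [leading_minor_gt0], which then applies once more to its reversal. *)
Lemma contiguous_principal_minor_gt0 (m r a : nat) (A : 'M[R]_m)
    (f : 'I_r -> 'I_m) :
  totally_nonnegative A -> \det A != 0 ->
  (forall k : 'I_r, f k = a + k :> nat)%N -> 0 < minor f f A.
Proof.
(* For r = 0 nothing bounds [a] by [m], so the empty minor is treated apart. *)
case: r f => [|r] f tnA detA fE; first by rewrite minor0 ltr01.
have hb : (a + r.+1 <= m)%N.
  by have := ltn_ord (f ord_max); rewrite fE addnS.
have le_b : (r.+1 <= a + r.+1)%N by rewrite leq_addl.
pose B := mxsub (first_idx hb) (first_idx hb) A.
have tnB : totally_nonnegative B.
  by apply: mxsub_tnn => //; apply: increasing_first_idx.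
have detB : \det B != 0 by rewrite gt_eqF // leading_minor_gt0.
have := leading_minor_gt0 le_b (rev_tnn tnB).
rewrite det_rev => /(_ detB).
rewrite minor_mxsub minor_mxsub /minor -det_rev -mxsub_comp.
set h := (X in mxsub X X _); suff hE : h =1 f.
  by congr (0 < _); apply: eq_minor.
by move=> k; apply: val_inj; rewrite /= fE; have := ltn_ord k; lia.
Qed.

End PrincipalMinors.

(** * Nontrivial index pairs, and gaps in index sequences *)

Lemma nontrivial_subP (n r p q : nat) (f g : 'I_r -> 'I_n) :
  reflect (forall k, (g k <= f k + q)%N /\ (f k <= g k + p)%N)
          (nontrivial_sub p q f g).
Proof.
rewrite /nontrivial_sub /trivial_sub negb_exists.
apply: (iffP forallP) => nt k; have := nt k.
  by rewrite negb_or -!leqNgt => /andP.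
by case=> le_gf le_fg; rewrite negb_or -!leqNgt le_gf le_fg.
Qed.

Lemma nontrivial_subC (n r p q : nat) (f g : 'I_r -> 'I_n) :
  nontrivial_sub p q f g = nontrivial_sub q p g f.
Proof. by congr (~~ _); apply: eq_existsb => k; rewrite orbC. Qed.

Lemma nontrivial_sub_comp (n r s p q : nat) (f g : 'I_r -> 'I_n)
    (h : 'I_s -> 'I_r) :
  nontrivial_sub p q f g -> nontrivial_sub p q (f \o h) (g \o h).
Proof.
by move=> /nontrivial_subP nt; apply/nontrivial_subP => k; apply: nt.
Qed.

Lemma contiguous_or_gap (n r : nat) (f : 'I_r.+1 -> 'I_n) :
  increasing f ->
  (forall k, f k = f ord0 + k :> nat)%N \/
  exists k l : 'I_r.+1, l = k.+1 :> nat /\ ((f k).+1 < f l)%N.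
Proof.
move=> incf; case: (boolP [exists k : 'I_r.+1, exists l : 'I_r.+1,
    (l == k.+1 :> nat) && ((f k).+1 < f l)%N]).
  by move=> /existsP[k /existsP[l /andP[/eqP lE gap]]]; right; exists k, l.
move=> /existsPn nogap; left => -[k ltk] /=.
elim: k ltk => [|k IH] ltk.
  by rewrite addn0; congr (f _ : nat); exact/val_inj.
have ltk' : (k < r.+1)%N by apply: ltnW.
have /existsPn/(_ (Ordinal ltk)) := nogap (Ordinal ltk').
rewrite /= eqxx /= -leqNgt IH => le_f.
have := incf (Ordinal ltk') (Ordinal ltk) (ltnSn k).
by rewrite IH; lia.
Qed.

(** * Nontrivial minors of banded matrices *)

Section BandedMinors.

Variable R : realType.

Lemma tr_banded (n p q : nat) (T : 'M[R]_n) : banded p q T -> banded q p T^T.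
Proof. by move=> bT i j out; rewrite mxE; apply: bT; rewrite orbC. Qed.

(** Rows from [l] on meet columns up to [k] below the band, so the submatrix is block upper
    triangular; both diagonal blocks are nonempty, hence of smaller order. *)
Lemma minor_split_gt0 (n p q r : nat) (T : 'M[R]_n) (f g : 'I_r -> 'I_n)
    (k l : 'I_r) :
  banded p q T ->
  (forall s (f' g' : 'I_s -> 'I_n), (s < r)%N -> increasing f' ->
     increasing g' -> nontrivial_sub p q f' g' -> 0 < minor f' g' T) ->
  increasing f -> increasing g -> nontrivial_sub p q f g ->
  l = k.+1 :> nat -> (g k + p < f l)%N -> 0 < minor f g T.
Proof.
move=> bT IH incf incg nt lE gap.
have T0 (i j : 'I_r) : (k < i)%N -> (j <= k)%N -> T (f i) (g j) = 0.
  move=> lt_ki le_jk; apply: bT; apply/orP; right.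
  have le_li : (l <= i)%N by rewrite lE.
  have := increasing_leq incf le_li; have := increasing_leq incg le_jk; lia.
have [b rE] : exists b, r = (k.+1 + b)%N.
  by exists (r - k.+1)%N; rewrite subnKC.
have b_gt0 : (0 < b)%N by have := ltn_ord l; lia.
move: (nat_of_ord k) rE T0 => a rE T0 {gap lE k l}.
subst r; rewrite minor_block0; last first.
  by move=> i j; apply: T0 => /=; have := ltn_ord j; lia.
have inc_l : increasing (@lshift a.+1 b) by [].
have inc_r : increasing (@rshift a.+1 b) by move=> i j; rewrite /= ltn_add2l.
apply: mulr_gt0; apply: IH.
- by rewrite -[X in (X < _)%N]addn0 ltn_add2l.
- exact: increasing_comp inc_l incf.
- exact: increasing_comp inc_l incg.
- exact: nontrivial_sub_comp nt.
- by rewrite addSn ltnS leq_addl.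
- exact: increasing_comp inc_r incf.
- exact: increasing_comp inc_r incg.
- exact: nontrivial_sub_comp nt.
Qed.

Lemma minor_gap_gt0 (n p q r : nat) (T : 'M[R]_n) (f g : 'I_r.+1 -> 'I_n)
    (k l : 'I_r.+1) :
  totally_nonnegative T ->
  (forall f' g' : 'I_r -> 'I_n, increasing f' -> increasing g' ->
     nontrivial_sub p q f' g' -> 0 < minor f' g' T) ->
  (forall f' : 'I_r.+1 -> 'I_n, increasing f' -> nontrivial_sub p q f' g ->
     (f ord0 < f' ord0)%N -> f' ord_max = f ord_max -> 0 < minor f' g T) ->
  increasing f -> increasing g -> nontrivial_sub p q f g ->
  (forall i j : 'I_r.+1, j = i.+1 :> nat -> (f j <= g i + p)%N) ->
  l = k.+1 :> nat -> ((f k).+1 < f l)%N -> 0 < minor f g T.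
Proof.
move=> tnT IHr IHspan incf incg nt nosplit lE gap.
(* The skipped row is [f k] + 1; [F] is [f] with this row inserted at position [s] = k + 1. *)
pose h := Ordinal (ltn_trans gap (ltn_ord (f l))).
pose s := lift ord0 k.
pose F i := oapp f h (unlift s i).
have FE : F \o lift s =1 f by move=> i; rewrite /F /= liftK.
have lift_small (i : 'I_r.+1) : (i <= k)%N -> lift s i = i :> nat.
  by move=> le_ik; rewrite /= /bump /= ltnNge le_ik.
have lift_large (i : 'I_r.+1) : (k < i)%N -> lift s i = i.+1 :> nat.
  by move=> lt_ki; rewrite /= /bump /= lt_ki.
have sE : s = k.+1 :> nat by [].
have incF : increasing F.
  move=> i j; rewrite /F.
  case: (unliftP s i) => [i'|] ->; case: (unliftP s j) => [j'|] ->.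
  - by rewrite /= !ltnNge leq_bump2 -!ltnNge; apply: incf.
  - rewrite sE; have [le_ik _|lt_ki] := leqP i' k; last first.
      by rewrite lift_large // ltnS ltnNge (ltnW lt_ki).
    by have := increasing_leq incf le_ik; rewrite /= ltnS.
  - rewrite sE; have [le_jk|lt_kj _] := leqP j' k.
      by rewrite lift_small // ltnNge (leqW le_jk).
    have le_lj : (l <= j')%N by rewrite lE.
    by have := increasing_leq incf le_lj; rewrite /=; lia.
  - by rewrite ltnn.
have lift0E (i : 'I_r.+1) : lift ord0 i = i.+1 :> nat by [].
have lift_bounds (i : 'I_r.+1) : (i <= lift s i <= i.+1)%N.
  by rewrite leq_addl -[i.+1]add1n leq_add2r leq_b1.
have lift_s0 : lift s ord0 = 0%N :> nat by rewrite lift_small.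
have lift_smax : lift s ord_max = lift ord0 ord_max.
  apply: val_inj; rewrite [LHS]lift_large //.
  by have := ltn_ord l; rewrite lE.
have inc0 : increasing (F \o lift ord0).
  exact: increasing_comp (@increasing_lift _ _) incF.
rewrite -(eq_minor _ FE (frefl g)); apply: minor_insert_gt0 => //.
- by rewrite sE /=; have := ltn_ord l; lia.
- apply: IHspan => //.
  (* Dropping the first row of [F] moves each row of [f] weakly downwards, which keeps the bound
     with q. For the bound with p, the new row i is at most row i + 1 of [f], where [nosplit]
     applies; the last row is unchanged. *)
  + apply/nontrivial_subP => i; split.
      have /nontrivial_subP/(_ i)[le_gf _] := nt; apply: leq_trans le_gf _.
      rewrite leq_add2r -[f i]FE /=; apply: (increasing_leq incF).
      by rewrite lift0E; case/andP: (lift_bounds i).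
    have [lt_ir|le_ri] := ltnP i r.
      have lt_ir' : (i.+1 < r.+1)%N by [].
      apply: leq_trans (nosplit i (Ordinal lt_ir') erefl).
      rewrite -[f _]FE; apply: (increasing_leq incF).
      by rewrite lift0E; case/andP: (lift_bounds (Ordinal lt_ir')).
    have -> : i = ord_max by apply: val_inj => /=; have := ltn_ord i; lia.
    rewrite /= -lift_smax -[F _]/((F \o lift s) _) FE.
    by have /nontrivial_subP/(_ ord_max)[] := nt.
  + by rewrite -[f ord0]FE; apply: incF; rewrite lift_s0.
  + by rewrite -[RHS]FE /= lift_smax.
- apply: IHr.
  + have incFs := increasing_comp (@increasing_lift _ s) incF.
    exact: increasing_comp (@increasing_lift _ _) incFs.
  + exact: increasing_comp (@increasing_lift _ _) incg.
  + apply: nontrivial_sub_comp; apply/nontrivial_subP => i.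
    by rewrite FE; have /nontrivial_subP := nt; apply.
Qed.

Lemma banded_tp_of_contiguous (n p q : nat) (T : 'M[R]_n) :
  banded p q T -> totally_nonnegative T ->
  (forall (r a b : nat) (f g : 'I_r.+1 -> 'I_n),
     (forall k, f k = a + k :> nat)%N -> (forall k, g k = b + k :> nat)%N ->
     nontrivial_sub p q f g -> 0 < minor f g T) ->
  banded_totally_positive p q T.
Proof.
move=> bT tnT contig r; elim/ltn_ind: r => -[|r] IHr f g.
  by rewrite minor0 ltr01.
have [N] := ubnP ((f ord_max - f ord0) + (g ord_max - g ord0))%N.
elim: N f g => // N IHN f g; rewrite ltnS => leN incf incg nt.
have IHlt s (f' g' : 'I_s -> 'I_n) : (s < r.+1)%N -> increasing f' ->
    increasing g' -> nontrivial_sub p q f' g' -> 0 < minor f' g' T.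
  by move=> lt_s; apply: IHr.
have f0max := increasing_leq incf (leq0n ord_max : (ord0 <= ord_max)%N).
have g0max := increasing_leq incg (leq0n ord_max : (ord0 <= ord_max)%N).
have [fE|[k [l [lE gap]]]] := contiguous_or_gap incf; last first.
  have [/existsP[i /existsP[j /andP[/eqP jE lt_gf]]]|nosplit] :=
      boolP [exists i : 'I_r.+1, exists j : 'I_r.+1,
          (j == i.+1 :> nat) && (g i + p < f j)%N].
    exact: minor_split_gt0 bT IHlt incf incg nt jE lt_gf.
  apply: (@minor_gap_gt0 n p q _ T _ _ _ _ tnT) lE gap => //.
  - by move=> f' g'; apply: IHlt.
  - move=> f' incf' nt' lt0 eqmax; apply: IHN => //.
    (* Subtraction is truncated: the span drops strictly because the new first row does not exceed
       the common last row. *)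
    have := increasing_leq incf' (leq0n ord_max : (ord0 <= ord_max)%N).
    rewrite eqmax; lia.
  - move=> i j jE; move: nosplit => /existsPn/(_ i)/existsPn/(_ j).
    by rewrite jE eqxx /= -leqNgt.
have [gE|[k [l [lE gap]]]] := contiguous_or_gap incg; last first.
  rewrite -minor_tr; rewrite nontrivial_subC in nt.
  have IHtr s (f' g' : 'I_s -> 'I_n) : (s < r.+1)%N -> increasing f' ->
      increasing g' -> nontrivial_sub q p f' g' -> 0 < minor f' g' T^T.
    by rewrite minor_tr nontrivial_subC => *; apply: IHlt.
  have [/existsP[i /existsP[j /andP[/eqP jE lt_gf]]]|nosplit] :=
      boolP [exists i : 'I_r.+1, exists j : 'I_r.+1,
          (j == i.+1 :> nat) && (f i + q < g j)%N].
    exact: minor_split_gt0 (tr_banded bT) IHtr incg incf nt jE lt_gf.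
  apply: (@minor_gap_gt0 n q p _ _ _ _ _ _ (tr_tnn tnT)) lE gap => //.
  - by move=> f' g'; apply: IHtr.
  - move=> g' incg' nt' lt0 eqmax; rewrite minor_tr.
    apply: IHN => //; last by rewrite nontrivial_subC.
    have := increasing_leq incg' (leq0n ord_max : (ord0 <= ord_max)%N).
    rewrite eqmax; lia.
  - move=> i j jE; move: nosplit => /existsPn/(_ i)/existsPn/(_ j).
    by rewrite jE eqxx /= -leqNgt.
exact: contig fE gE nt.
Qed.

(** The corner submatrix of order n - (b - a) has the superdiagonal of offset b - a as its main
    diagonal, so the given minor is a contiguous principal minor of it. Nontriviality gives b - a <=
    q, which makes the corner nontrivial too. *)
Lemma contiguous_minor_gt0 (n p q r a b : nat) (T : 'M[R]_n)
    (f g : 'I_r.+1 -> 'I_n) :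
  totally_nonnegative T ->
  (forall (i : nat) (hi : (i <= n)%N), (1 <= i)%N ->
     nontrivial_sub p q (first_idx hi) (last_idx hi) ->
     upper_corner_minor hi T != 0) ->
  (a <= b)%N ->
  (forall k, f k = a + k :> nat)%N -> (forall k, g k = b + k :> nat)%N ->
  nontrivial_sub p q f g -> 0 < minor f g T.
Proof.
move=> tnT corner le_ab fE gE /nontrivial_subP nt.
have hi : (n - (b - a) <= n)%N by rewrite leq_subr.
have := corner _ hi; have [ntb _] := nt ord0; move: ntb; rewrite fE gE !addn0.
have := ltn_ord (g ord_max); rewrite gE /= => ltbn le_ba.
have i_gt0 : (1 <= n - (b - a))%N by lia.
move=> /(_ i_gt0) det_neq0.
pose S := mxsub (first_idx hi) (last_idx hi) T.
have detS : \det S != 0.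
  apply: det_neq0; apply/nontrivial_subP => k /=; lia.
have lt_idx (k : 'I_r.+1) : (a + k < n - (b - a))%N.
  by have := ltn_ord k; lia.
have tnS : totally_nonnegative S.
  by apply: mxsub_tnn => //; apply: increasing_last_idx.
have := @contiguous_principal_minor_gt0 R _ _ a S (fun k => Ordinal (lt_idx k))
  tnS detS (fun=> erefl).
rewrite minor_mxsub; congr (0 < _); apply: eq_minor => k; apply: val_inj => /=.
  by rewrite fE.
by rewrite gE; lia.
Qed.

End BandedMinors.

Theorem theorem2p17 (R : realType) (n p q : nat) (T : 'M[R]_n)
  (hp : (p <= n)%N) (hq : (q <= n)%N)
  (Tband : banded p q T)
  (Tunit : T \in unitmx)
  (Ttn : totally_nonnegative T) :
  banded_totally_positive p q T <->
  (forall (i : nat) (hi : (i <= n)%N), (1 <= i)%N ->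
     (nontrivial_sub p q (first_idx hi) (last_idx hi) ->
        upper_corner_minor hi T != 0) /\
     (nontrivial_sub p q (last_idx hi) (first_idx hi) ->
        lower_corner_minor hi T != 0)).
Proof.
split=> [btp i hi _|corner].
  split=> nt; rewrite gt_eqF //; apply: btp => //;
    by [apply: increasing_first_idx | apply: increasing_last_idx].
apply: banded_tp_of_contiguous => // r a b f g fE gE nt.
have [le_ab|lt_ba] := leqP a b.
  by apply: contiguous_minor_gt0 le_ab fE gE nt => // i hi /(corner i hi)[].
(* Transposition exchanges p with q and the lower corner minors with the upper ones. *)
rewrite -minor_tr; rewrite nontrivial_subC in nt.
apply: contiguous_minor_gt0 (tr_tnn Ttn) _ (ltnW lt_ba) gE fE nt => i hi i_gt0.
rewrite nontrivial_subC /upper_corner_minor minor_tr.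
by have [] := corner i hi i_gt0.
Qed.
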